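(* Let $\pi$ be a Lebesgue probability density on $\mathbb{R}^k$ with $\nabla\log\pi$ Lipschitz continuous, and fix a symmetric positive definite $\Lambda\in\mathbb{R}^{k\times k}$. The value $l=l_\Lambda>0$ which maximises the time-change factor $l^2a_\Lambda(l)$ over $l>0$ is $$l_\Lambda\approx\frac{2.38}{\sqrt{\Sigma:\Lambda}},$$ and it satisfies $a_\Lambda(l_\Lambda)\approx0.234$. Moreover $G^{l_\Lambda,\Lambda}=c\,G^\Lambda$, where the acceleration factor $c=l_\Lambda^2\,a_\Lambda(l_\Lambda)\,(\Lambda:\Sigma)/2\approx0.66$ is universal: it does not depend on $k$, $\pi$ or $\Lambda$. (Here $\approx$ means equality after rounding the numerical constant to the number of digits displayed.)
   Context: The Lipschitz assumption is understood to include that $\log\pi$ is finite and differentiable on $\mathbb{R}^k$. Let $\Sigma=\mathrm{Var}_{X\sim\pi}(\nabla\log\pi(X))$, $A:B=\sum_{i,j}A_{ji}B_{ij}$, and $a_\Lambda(l)=2\Phi\big(-\tfrac{l\sqrt{\Sigma:\Lambda}}{2}\big)$, with $\Phi$ the standard normal distribution function. The limiting diffusion generator with scaling $l$ and shaping $\Lambda$ is $$G^{l,\Lambda}f=k\,l^2a_\Lambda(l)\Big(\tfrac12\Lambda:\nabla^2f+\tfrac12[\nabla\log\pi]'\Lambda\nabla f\Big),$$ and the generator at standardised speed is $$G^{\Lambda}f=k\Big(\frac{\Lambda}{\Lambda:\Sigma}:\nabla^2f+[\nabla\log\pi]'\frac{\Lambda}{\Lambda:\Sigma}\nabla f\Big).$$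 *)

(* Defs.v *)
From HB Require Import structures.
From mathcomp Require Import all_boot all_order all_algebra.
From mathcomp Require Import all_classical all_reals all_analysis.

Set Implicit Arguments.
Unset Strict Implicit.
Unset Printing Implicit Defensive.
Import Order.TTheory GRing.Theory Num.Theory.
Import numFieldNormedType.Exports.

Local Open Scope classical_set_scope.
Local Open Scope ring_scope.

(* R^n is 'rV[R]_n. Its measurable sets are those of the sigma-algebra generated
   by the coordinates (the Borel sigma-algebra), as for n.-tuple R. *)
Definition measure_rV_display : measure_display.
Proof. exact: (measure_tuple_display default_measure_display). Qed.

Section measurable_rV.
Context {R : realType} (n : nat).

Definition rV_coord (i : 'I_n) (v : 'rV[R]_n) : measurableTypeR R := v ord0 i.

Let rV_set0 : g_sigma_preimage rV_coord set0.
Proof. exact: sigma_algebra0. Qed.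

Let rV_setC A : g_sigma_preimage rV_coord A -> g_sigma_preimage rV_coord (~` A).
Proof. exact: sigma_algebraC. Qed.

Let rV_bigcup (F : _^nat) : (forall i, g_sigma_preimage rV_coord (F i)) ->
  g_sigma_preimage rV_coord (\bigcup_i (F i)).
Proof. exact: sigma_algebra_bigcup. Qed.

HB.instance Definition _ := @isMeasurable.Build measure_rV_display
  'rV[R]_n (g_sigma_preimage rV_coord) rV_set0 rV_setC rV_bigcup.

End measurable_rV.

Section measurable_rV_theory.
Context {R : realType}.

Lemma measurable_rV_coord n (i : 'I_n) :
  measurable_fun [set: 'rV[R]_n] (rV_coord i).
Proof.
move=> _ Y mY; rewrite setTI; apply: sub_sigma_algebra => /=.
rewrite -bigcup_seq/=; exists i => /=; first by rewrite mem_index_enum.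
by exists Y => //; rewrite setTI.
Qed.

Lemma measurable_fun_rVP d (T : measurableType d) n (f : T -> 'rV[R]_n) :
  (forall i, measurable_fun [set: T] (rV_coord i \o f)) ->
  measurable_fun [set: T] f.
Proof.
move=> mf; suff : g_sigma_preimage (fun i => rV_coord i \o f) `<=` measurable.
  rewrite g_sigma_preimage_comp => prefS _ A mA.
  by apply: prefS; exists A.
apply: smallest_sub; first exact: sigma_algebra_measurable.
case: n => [|n] in f mf *; first by rewrite big_ord0.
rewrite -bigcup_mkord_ord; apply: bigcup_sub => i Ii.
by move=> A [B mB <-]; exact: mf.
Qed.

Definition rV_cons n (p : measurableTypeR R * 'rV[R]_n) : 'rV[R]_n.+1 :=
  \row_(i < n.+1) oapp (p.2 ord0) p.1 (unlift ord0 i).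

Lemma measurable_rV_cons n : measurable_fun setT (@rV_cons n).
Proof.
apply: measurable_fun_rVP => i.
case: (unliftP ord0 i) => [j ->|->].
  rewrite (_ : _ \o _ = rV_coord j \o snd).
    exact: measurableT_comp (measurable_rV_coord j) measurable_snd.
  by apply/funext => p; rewrite /= /rV_coord mxE liftK.
rewrite (_ : _ \o _ = fst); first exact: measurable_fst.
by apply/funext => p; rewrite /= /rV_coord mxE unlift_none.
Qed.

End measurable_rV_theory.

Section lebesgue_rV.
Context {R : realType}.

Section step.
Context n (mu : {sigma_finite_measure set 'rV[R]_n -> \bar R}).

Definition lebesgue_rV_step : set 'rV[R]_n.+1 -> \bar R :=
  pushforward (lebesgue_measure \x mu)%E (@rV_cons R n).

Let step_preimage A : measurable A -> measurable (@rV_cons R n @^-1` A).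
Proof.
by move=> mA; rewrite -[X in measurable X]setTI; exact: measurable_rV_cons.
Qed.

Let step0 : lebesgue_rV_step set0 = 0%E.
Proof. by rewrite /lebesgue_rV_step /pushforward preimage_set0 measure0. Qed.

Let step_ge0 A : (0 <= lebesgue_rV_step A)%E.
Proof. by rewrite /lebesgue_rV_step /pushforward. Qed.

Let step_sigma_additive : semi_sigma_additive lebesgue_rV_step.
Proof.
move=> F mF tF mUF; rewrite /lebesgue_rV_step /pushforward preimage_bigcup.
apply: measure_semi_sigma_additive.
- by move=> i; exact: step_preimage.
- apply/trivIsetP => /= i j _ _ ij; rewrite -preimage_setI.
  by move/trivIsetP : tF => /(_ _ _ _ _ ij) ->//; rewrite preimage_set0.
- by rewrite -preimage_bigcup; exact: step_preimage.
Qed.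

HB.instance Definition _ := isMeasure.Build _ _ _ lebesgue_rV_step
  step0 step_ge0 step_sigma_additive.

Let step_sigma_finite : sigma_finite setT lebesgue_rV_step.
Proof.
have /sigma_finiteP[F [TF ndF Foo]] :=
  sigma_finiteT (@lebesgue_measure R : {sigma_finite_measure set _ -> \bar R}).
have /sigma_finiteP[G [TG ndG Goo]] := sigma_finiteT mu.
pose tl (v : 'rV[R]_n.+1) : 'rV[R]_n := \row_j v ord0 (lift ord0 j).
exists (fun i => [set v : 'rV[R]_n.+1 | F i (rV_coord ord0 v) /\ G i (tl v)]).
  apply/esym; rewrite -subTset => v _.
  have : setT (rV_coord ord0 v) by [].
  have : setT (tl v) by [].
  rewrite TF TG => -[a _ Ga] [b _ Fb]; exists (maxn a b) => //; split.
    by move: Fb; apply/subsetPset/ndF/leq_maxr.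
  by move: Ga; apply/subsetPset/ndG/leq_maxl.
move=> i; have [mF Fi] := Foo i; have [mG Gi] := Goo i; split.
  apply: measurableI.
    by rewrite -[X in measurable X]setTI; exact: measurable_rV_coord.
  rewrite -[X in measurable X]setTI.
  have mtl : measurable_fun setT tl.
    apply: measurable_fun_rVP => j.
    rewrite (_ : _ \o _ = rV_coord (lift ord0 j)).
      exact: measurable_rV_coord.
    by apply/funext => v; rewrite /= /rV_coord mxE.
  exact: mtl.
rewrite /lebesgue_rV_step /pushforward (_ : _ @^-1` _ = F i `*` G i).
  by rewrite product_measure1E// lte_mul_pinfty// ge0_fin_numE.
have coE p : rV_coord ord0 (@rV_cons R n p) = p.1.
  by rewrite /rV_coord mxE unlift_none.
have tlE p : tl (@rV_cons R n p) = p.2.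
  by apply/rowP => j; rewrite !mxE liftK.
by apply/seteqP; split=> p; rewrite /preimage /= coE tlE.
Qed.

HB.instance Definition _ :=
  Measure_isSigmaFinite.Build _ _ _ lebesgue_rV_step step_sigma_finite.

End step.

(* n-dimensional Lebesgue measure: the n-fold product of the Lebesgue measure
   on R, with a unit mass on R^0. *)
Fixpoint lebesgue_rV n : {sigma_finite_measure set 'rV[R]_n -> \bar R} :=
  match n with
  | 0 => \d_(0 : 'rV[R]_0)
  | n'.+1 => lebesgue_rV_step (lebesgue_rV n')
  end.

End lebesgue_rV.
Arguments lebesgue_rV : clear implicits.

Lemma lebesgue_rV_box {R : realType} n (A : 'I_n -> set (measurableTypeR R)) :
  (forall i, measurable (A i)) ->
  lebesgue_rV R n [set v | forall i, A i (rV_coord i v)] =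
  (\prod_(i < n) lebesgue_measure (A i))%E.
Proof.
elim: n A => [|n IHn] A mA.
  by rewrite big_ord0 /= diracE mem_set//= => -[].
have mB : measurable [set v : 'rV[R]_n |
    forall i, A (lift ord0 i) (rV_coord i v)].
  rewrite (_ : mkset _ = \big[setI/setT]_(i < n)
      ([set: 'rV[R]_n] `&` rV_coord i @^-1` A (lift ord0 i))).
    apply: bigsetI_measurable => i _.
    exact: (measurable_rV_coord i).
  rewrite -bigcap_seq; apply/seteqP; split=> v /=.
    by move=> Av i _; split => //; exact: Av.
  by move=> Av i; have [] := Av i (mem_index_enum i).
rewrite big_ord_recl -IHn//= /lebesgue_rV_step /pushforward.
rewrite -product_measure1E//; congr (product_measure1 _ _ _).
apply/seteqP; split=> -[x v] /=.
  move=> Av; split=> [|i /=].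
    by have := Av ord0; rewrite /rV_coord mxE unlift_none.
  by have := Av (lift ord0 i); rewrite /rV_coord mxE liftK.
move=> [Ax Av] i; rewrite /rV_coord mxE.
by case: unliftP => [j ->|->] //=; exact: Av.
Qed.

(* pi is a density of the law P with respect to Lebesgue measure on R^k. *)
Definition has_density {R : realType} k (P : probability 'rV[R]_k R)
    (pi : 'rV[R]_k -> R) : Prop :=
  [/\ measurable_fun setT pi, forall x, 0 <= pi x &
      forall A, measurable A ->
        P A = (\int[lebesgue_rV R k]_(x in A) (pi x)%:E)%E].

Definition sym_posdef {R : realType} k (Lam : 'M[R]_k) : Prop :=
  Lam^T = Lam /\
  forall v : 'rV[R]_k, v != 0 -> 0 < (v *m Lam *m v^T) ord0 ord0.

(* A : B *)
Definition ddot {R : realType} k (A B : 'M[R]_k) : R :=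
  \sum_(i < k) \sum_(j < k) A j i * B i j.

(* Gradients are row vectors. *)
Definition grad {R : realType} k (f : 'rV[R]_k -> R) (x : 'rV[R]_k) : 'rV[R]_k :=
  \row_(i < k) 'D_(delta_mx ord0 i) f x.

Definition hess {R : realType} k (f : 'rV[R]_k -> R) (x : 'rV[R]_k) : 'M[R]_k :=
  \matrix_(i < k, j < k)
    'D_(delta_mx ord0 i) (fun y => 'D_(delta_mx ord0 j) f y) x.

Definition log_density {R : realType} k (pi : 'rV[R]_k -> R) (x : 'rV[R]_k) : R :=
  ln (pi x).

Definition score {R : realType} k (pi : 'rV[R]_k -> R) : 'rV[R]_k -> 'rV[R]_k :=
  grad (log_density pi).

(* Covariance matrix of score pi X for X ~ P. *)
Definition Sigma {R : realType} k (P : probability 'rV[R]_k R)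
    (pi : 'rV[R]_k -> R) : 'M[R]_k :=
  \matrix_(i < k, j < k)
    fine (covariance P (fun x => score pi x ord0 i)
                       (fun x => score pi x ord0 j)).

Definition Phi {R : realType} (x : R) : R :=
  fine (normal_prob 0 1 `]-oo, x]%classic).

(* a_Lambda(l) *)
Definition acceptance {R : realType} k (P : probability 'rV[R]_k R)
    (pi : 'rV[R]_k -> R) (Lam : 'M[R]_k) (l : R) : R :=
  2 * Phi (- (l * Num.sqrt (ddot (Sigma P pi) Lam) / 2)).

(* G^{l,Lambda}; the derivatives are total, so f is not restricted here. *)
Definition generator {R : realType} k (P : probability 'rV[R]_k R)
    (pi : 'rV[R]_k -> R) (l : R) (Lam : 'M[R]_k)
    (f : 'rV[R]_k -> R) (x : 'rV[R]_k) : R :=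
  k%:R * l ^+ 2 * acceptance P pi Lam l *
  (2^-1 * ddot Lam (hess f x) +
   2^-1 * (score pi x *m Lam *m (grad f x)^T) ord0 ord0).

(* G^Lambda *)
Definition std_generator {R : realType} k (P : probability 'rV[R]_k R)
    (pi : 'rV[R]_k -> R) (Lam : 'M[R]_k)
    (f : 'rV[R]_k -> R) (x : 'rV[R]_k) : R :=
  let Lam1 := (ddot Lam (Sigma P pi))^-1 *: Lam in
  k%:R * (ddot Lam1 (hess f x) +
          (score pi x *m Lam1 *m (grad f x)^T) ord0 ord0).

Definition maximises_on_pos {R : realType} (F : R -> R) (l : R) : Prop :=
  0 < l /\ forall m, 0 < m -> F m <= F l.

(* x rounds to q, q having d decimal digits; the inequality is strict, so no
   tie-breaking convention is involved. *)
Definition rounds_to {R : realType} (d : nat) (x q : R) : Prop :=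
  `|x - q| < 2^-1 * 10^-1 ^+ d.

(* Main.v *)
Require Import Defs.
From mathcomp Require Import all_boot all_order all_algebra.
From mathcomp Require Import all_classical all_reals all_analysis.
From HB Require Import structures.
From mathcomp Require Import measurable_realfun ring lra.
Import Order.TTheory GRing.Theory Num.Theory.
Import numFieldNormedType.Exports.
Local Open Scope ring_scope.

(** With m = 2 y / sqrt (Sigma : Lambda) the time-change factor is a constant
    multiple of h(y) = y^2 Phi(-y), so everything reduces to one scalar problem
    as soon as Sigma : Lambda > 0.

    Scalar problem: h' = y g with g(y) = 2 Phi(-y) - y phi(y), and
    g' = (y^2 - 3) phi.  Hence g decreases from g(0) = 1 on [0, sqrt 3], then
    increases to 0 at infinity, and has a single zero y0, the unique maximiser.
    There 2 Phi(-y0) = y0 phi(y0), and Taylor bounds give 44/37 < y0 < 56/47.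

    Positivity: if K dominates the oscillation of the score along a unit step e,
    then pi (x + e) >= pi x exp (s_e x - K), and likewise for -e.  Adding the two
    and integrating, translation invariance of Lebesgue measure yields
    E[s_e^2] <= 4 exp K, so Sigma is a genuine covariance matrix and
    Sigma : Lambda = E[(s - m) Lambda (s - m)'].  If this vanished, the
    continuous function s would be constant, so pi (x + t e) = exp (t c) pi x;
    integrating gives c = 0, and a coordinate of X would then have a constant
    distribution function. *)

(** * The scalar problem *)

Section scalar_problem.
Local Open Scope classical_set_scope.
Local Open Scope ring_scope.
Context {R : realType}.
Implicit Types x y : R.

(** The mean value theorem for [g - f] on [0, x]. It integrates an inequality between derivatives;
    the Taylor bounds below come from iterating it. *)
Lemma le_of_le_derive (f g df dg : R -> R) :
  (forall x, is_derive x (1 : R) f (df x)) ->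
  (forall x, is_derive x (1 : R) g (dg x)) ->
  f 0 <= g 0 -> (forall x, 0 <= x -> df x <= dg x) ->
  forall x, 0 <= x -> f x <= g x.
Proof.
move=> Df Dg fg0 dfg x x0.
have Dh z : is_derive z (1 : R) (g - f) (dg z - df z) by exact: is_deriveB.
have [c + E] := @MVT_segment R (g - f) (fun z => dg z - df z) 0 x x0
  (fun z _ => Dh z)
  (derivable_within_continuous (fun z _ => @ex_derive _ _ _ _ _ _ _ (Dh z))).
rewrite in_itv/= => /andP[c0 _].
have := mulr_ge0 (_ : 0 <= dg c - df c) x0; rewrite subr_ge0 dfg// => /(_ isT).
by move: E; rewrite !fctE subr0 => <-; lra.
Qed.

(** * Alternating Taylor bounds for exp(-x), cosine and sine *)

Definition expN_poly n : {poly R} := \poly_(i < n) ((-1) ^+ i / i`!%:R).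

Lemma deriv_expN_poly n : (expN_poly n.+1)^`() = - expN_poly n.
Proof.
apply/polyP => i; rewrite coef_deriv coefN !coef_poly ltnS; case: ifP => _.
  have [ai bi] : i`!%:R != 0 :> R /\ i.+1%:R != 0 :> R.
    by rewrite !pnatr_eq0 -lt0n fact_gt0.
  rewrite factS natrM exprS mulN1r -[LHS]mulr_natr mulNr mulNr; congr (- _).
  by rewrite invfM mulrA mulrAC mulfVK.
by rewrite mul0rn oppr0.
Qed.

(** Differentiation turns the sum of n + 1 terms into minus the sum of n terms, and exp(-x) into its
    opposite. So an upper bound integrates to a lower bound with one more term, and conversely,
    starting from 0 <= exp(-x) <= 1. *)
Lemma expN_poly_bounds n x : 0 <= x ->
  (expN_poly n.*2).[x] <= expR (- x) <= (expN_poly n.*2.+1).[x].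
Proof.
have De y : is_derive y (1 : R) (fun z => expR (- z)) (- expR (- y)).
  apply: is_derive_eq; last by rewrite mulrN1.
elim: n x => [|n IH] x x0.
  rewrite /expN_poly/= !horner_poly big_ord0 big_ord1 expR_ge0/=.
  by rewrite expr0 mulr1 fact0 divr1 -expR0 ler_expR oppr_le0.
have Dp m y : is_derive y (1 : R) (fun z => (expN_poly m.+1).[z])
    (- (expN_poly m).[y]).
  by rewrite -hornerN -deriv_expN_poly; exact: is_derive_poly.
have p0 m : (expN_poly m.+1).[0] = 1 by rewrite horner_coef0 coef_poly/= divr1.
have lb y : 0 <= y -> (expN_poly n.+1.*2).[y] <= expR (- y).
  rewrite doubleS => y0.
  apply: (le_of_le_derive (horner (expN_poly n.*2.+2)) (fun z => expR (- z))
    _ _ (Dp _) De) => //.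
    by rewrite p0 oppr0 expR0.
  by move=> z z0; rewrite lerN2; have /andP[] := IH z z0.
rewrite lb//=.
apply: (le_of_le_derive (fun z => expR (- z)) (horner (expN_poly n.+1.*2.+1))
  _ _ De (Dp _)) => //.
  by rewrite p0 oppr0 expR0.
by move=> z z0; rewrite lerN2 lb.
Qed.

Definition cos_poly n : {poly R} :=
  \sum_(i < n) ((-1) ^+ i / i.*2`!%:R) *: 'X^(i.*2).
Definition sin_poly n : {poly R} :=
  \sum_(i < n) ((-1) ^+ i / i.*2.+1`!%:R) *: 'X^(i.*2.+1).

Lemma invr_factSMn n : (n.+1`!%:R)^-1 *+ n.+1 = (n`!%:R)^-1 :> R.
Proof.
by rewrite factS natrM invfM -[LHS]mulr_natl mulrA divff ?mul1r.
Qed.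

Lemma deriv_sin_poly n : (sin_poly n)^`() = cos_poly n.
Proof.
rewrite /sin_poly /cos_poly raddf_sum; apply: eq_bigr => i _.
by rewrite [LHS]derivZ derivXn /= -scalerMnr scalerMnl -mulrnAr invr_factSMn.
Qed.

Lemma deriv_cos_poly n : (cos_poly n.+1)^`() = - sin_poly n.
Proof.
rewrite /sin_poly /cos_poly raddf_sum big_ord_recl/= derivZ derivXn.
rewrite mulr0n scaler0 add0r -sumrN; apply: eq_bigr => i _.
rewrite [LHS]derivZ derivXn -scalerMnr scalerMnl -mulrnAr /bump /= add1n doubleS.
by rewrite invr_factSMn exprS mulN1r mulNr scaleNr.
Qed.

(** Integration runs through a cycle: cosine from above, sine from above, cosine from below, sine
    from below, cosine from above again. One turn adds two terms, and cos <= 1 starts it. *)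
Lemma trigo_poly_bounds n x : 0 <= x ->
  (cos_poly n.*2.+2).[x] <= cos x <= (cos_poly n.*2.+1).[x] /\
  (sin_poly n.*2.+2).[x] <= sin x <= (sin_poly n.*2.+1).[x].
Proof.
have Ds m y : is_derive y (1 : R) (horner (sin_poly m)) (cos_poly m).[y].
  by rewrite -deriv_sin_poly; exact: is_derive_poly.
have Dc m y : is_derive y (1 : R) (horner (cos_poly m.+1)) (- (sin_poly m).[y]).
  by rewrite -hornerN -deriv_cos_poly; exact: is_derive_poly.
have s0 m : (sin_poly m).[0] = 0.
  rewrite /sin_poly horner_sum big1// => i _.
  by rewrite hornerZ hornerXn expr0n mulr0.
have c0 m : (cos_poly m.+1).[0] = 1.
  rewrite /cos_poly big_ord_recl hornerD horner_sum big1 ?addr0 => [|i _].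
    by rewrite hornerZ hornerXn !expr0 fact0 divr1 mulr1.
  by rewrite hornerZ hornerXn expr0n /bump/= doubleS mulr0.
have sin_le m : (forall y, 0 <= y -> cos y <= (cos_poly m).[y]) ->
    forall y, 0 <= y -> sin y <= (sin_poly m).[y].
  move=> H y; apply: (le_of_le_derive _ _ _ _ (@is_derive_sin R) (Ds m)) => //.
  by rewrite s0 sin0.
have cos_ge m : (forall y, 0 <= y -> sin y <= (sin_poly m).[y]) ->
    forall y, 0 <= y -> (cos_poly m.+1).[y] <= cos y.
  move=> H y; apply: (le_of_le_derive _ _ _ _ (Dc m) (@is_derive_cos R)).
    by rewrite c0 cos0.
  by move=> z z0; rewrite lerN2 H.
have sin_ge m : (forall y, 0 <= y -> (cos_poly m).[y] <= cos y) ->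
    forall y, 0 <= y -> (sin_poly m).[y] <= sin y.
  move=> H y; apply: (le_of_le_derive _ _ _ _ (Ds m) (@is_derive_sin R)) => //.
  by rewrite s0 sin0.
have cos_le m : (forall y, 0 <= y -> (sin_poly m).[y] <= sin y) ->
    forall y, 0 <= y -> cos y <= (cos_poly m.+1).[y].
  move=> H y; apply: (le_of_le_derive _ _ _ _ (@is_derive_cos R) (Dc m)).
    by rewrite c0 cos0.
  by move=> z z0; rewrite lerN2 H.
have cle : forall y, 0 <= y -> cos y <= (cos_poly n.*2.+1).[y].
  elim: n => [|n IH]; last first.
    exact/cos_le/sin_ge/cos_ge/sin_le/IH.
  move=> y _; rewrite /cos_poly big_ord1 hornerZ hornerXn.
  by rewrite !expr0 fact0 divr1 mulr1 cos_le1.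
move=> x0; have sle := sin_le _ cle; have cge := cos_ge _ sle.
by rewrite cle// sle// cge// sin_ge.
Qed.

Lemma horner_cos_poly5 x : (cos_poly 5).[x] =
  1 - x ^+ 2 / 2 + x ^+ 4 / 24 - x ^+ 6 / 720 + x ^+ 8 / (56 * 720).
Proof.
rewrite /cos_poly horner_sum !big_ord_recr big_ord0/= !(hornerZ, hornerXn).
rewrite !doubleS double0.
rewrite (factS 7) (natrM _ 8) (factS 6) (natrM _ 7).
have [-> -> ->] : [/\ 2`! = 2, 4`! = 24 & 6`! = 720]%N by [].
by rewrite fact0; field.
Qed.

Lemma horner_cos_poly6 x :
  (cos_poly 6).[x] = (cos_poly 5).[x] - x ^+ 10 / (90 * 56 * 720).
Proof.
rewrite /cos_poly big_ord_recr hornerD/= hornerZ hornerXn; congr (_ + _).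
rewrite !doubleS double0.
rewrite (factS 9) (natrM _ 10) (factS 8) (natrM _ 9) (factS 7) (natrM _ 8).
rewrite (factS 6) (natrM _ 7) (_ : 6`! = 720)%N//.
by field.
Qed.

(** Cosine decreases on [0, pi] and vanishes at pi / 2, so its signs at 377/240 and 333/212 locate
    pi / 2. The crude bound 2 <= pi places both points in that interval. *)
Lemma pi_bounds : 333 / 106 < (pi : R) < 377 / 120.
Proof.
have [p2 p4] : 2 <= (pi : R) /\ (pi : R) <= 4.
  by have := @pi_ge2 R; have := @pihalf_lt2 R; lra.
have [/andP[_ c1] _] := trigo_poly_bounds 2 (377 / 240 : R) ltac:(lra).
have [/andP[c2 _] _] := trigo_poly_bounds 2 (333 / 212 : R) ltac:(lra).
have : cos (377 / 240) < cos (pi / 2) :> R.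
  by rewrite cos_pihalf (le_lt_trans c1)// horner_cos_poly5; lra.
have : cos (pi / 2) < cos (333 / 212) :> R.
  rewrite cos_pihalf (lt_le_trans _ c2)// horner_cos_poly6 horner_cos_poly5.
  lra.
rewrite !ltr_cos ?in_itv/=; lra.
Qed.

(** * The standard normal density and distribution function *)

Definition gauss_peak : R := (Num.sqrt (pi *+ 2))^-1.

Definition gauss_density x : R :=
  gauss_peak * expR (- (x ^+ 2 / 2)).

Lemma normal_pdf01E : normal_pdf 0 1 = gauss_density.
Proof.
apply/funext => x; rewrite normal_pdfE ?oner_eq0// /normal_peak /normal_fun.
by rewrite expr1n mul1r subr0 mulNr.
Qed.

Lemma is_derive_Phi x : is_derive x (1 : R) Phi (gauss_density x).
Proof.
have xx1 : x < x + 1 by rewrite ltrDl.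
have intf : (@lebesgue_measure R).-integrable `]-oo, (x + 1)%R]
    (EFin \o normal_pdf 0 1).
  by apply: integrableS (integrable_normal_pdf 0 1).
have cf : {for x, continuous (@normal_pdf R 0 1)}.
  by apply: continuous_normal_pdf; rewrite oner_eq0.
have [dF F'] := continuous_FTC1 xx1 intf (ltNyr _) cf.
split; first exact: dF.
by rewrite -derive1E -normal_pdf01E -F'.
Qed.

(** The density is even, so both half-lines carry the same mass. *)
Lemma Phi0 : Phi (0 : R) = 1 / 2.
Proof.
have ev x : normal_pdf 0 1 (- x) = normal_pdf 0 1 x :> R.
  by rewrite normal_pdf01E /gauss_density sqrrN.
have cpdf : continuous (@normal_pdf R 0 1).
  by apply: continuous_normal_pdf; rewrite oner_eq0.
(* The bound 0 is written as -0 to match the substitution x -> -x on a left half-line. *)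
have : (Phi 0)%:E = normal_prob 0 1 `]-oo, (- 0)%R] :> \bar R.
  by rewrite oppr0 fineK//; exact: (fin_num_measure (normal_prob 0 1)).
rewrite /normal_prob ge0_integration_by_substitutionNy; first last.
- by move=> ? ? ; exact: normal_pdf_ge0.
- exact: continuous_subspaceT.
under eq_integral do rewrite /= ev.
move=> E; have := @integral_normal_pdf R 0 1.
rewrite ge0_symfun_integralT//; first last.
- by move=> x; rewrite /= ev.
- by move=> x; exact: normal_pdf_ge0.
rewrite -set_itvcy -E -EFinM => -[]; lra.
Qed.

(** Under the normal law the identity is a random variable with distribution function [Phi], so the
    general limit of a [cdf] at -oo applies. *)
Lemma cvg_Phi_oppr : Phi (- x) @[x --> +oo%R] --> (0 : R).
Proof.
pose idTR : measurableTypeR R -> R := idfun.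
pose idRV := @isMeasurableFun.Build _ _ _ _ idTR (@measurable_id _ _ setT).
pose X : {RV (normal_prob 0 1 : probability _ R) >-> R} := HB.pack idTR idRV.
have := @cvg_cdfNy0 _ _ _ _ X.
rewrite cvgNy_compNP => H.
by apply: (cvg_trans _ (fine_cvg H)).
Qed.

Lemma lt_of_derive_gt0 (f df : R -> R) a b :
  (forall x, is_derive x (1 : R) f (df x)) -> a < b ->
  (forall x, a < x < b -> 0 < df x) -> f a < f b.
Proof.
move=> Df ab df0; rewrite -subr_gt0.
have [c + ->] := @MVT R f df a b ab (fun z _ => Df z)
  (derivable_within_continuous (fun z _ => @ex_derive _ _ _ _ _ _ _ (Df z))).
by rewrite in_itv/= => cab; rewrite mulr_gt0 ?df0// subr_gt0.
Qed.

(** * Monotonicity of the scalar objective *)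

Definition upper_tail y : R := Phi (- y).

Lemma gauss_density_gt0 y : 0 < gauss_density y.
Proof.
by rewrite mulr_gt0 ?expR_gt0// invr_gt0 sqrtr_gt0 pmulrn_lgt0// pi_gt0.
Qed.

Lemma is_derive_upper_tail y :
  is_derive y (1 : R) upper_tail (- gauss_density y).
Proof.
have D := is_derive_Phi (- y).
apply: (is_derive_eq (@is_derive1_comp _ Phi -%R _ _ _ D (is_deriveNid _ _))).
by rewrite mulrN1 /gauss_density sqrrN.
Qed.

Lemma is_derive_gauss_density y :
  is_derive y (1 : R) gauss_density (- (y * gauss_density y)).
Proof.
have Du : is_derive y (1 : R) (fun z : R => - (z ^+ 2 / 2)) (- y).
  have -> : (fun z : R => - (z ^+ 2 / 2)) = horner (- (2^-1 *: 'X^2) : {poly R}).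
    by apply/funext => z; rewrite hornerN hornerZ hornerXn mulrC.
  apply: is_derive_eq.
  rewrite derivN derivZ derivXn hornerN hornerZ hornerMn hornerXn.
  by rewrite /= expr1; field.
have De := @is_derive1_comp _ expR _ y _ _ (is_derive_expR _) Du.
apply: (is_derive_eq (is_deriveZ gauss_peak De)).
by rewrite /gauss_density /GRing.scale/=; ring.
Qed.

(** The function g of the overview; [objective] below is h. *)
Definition marginal y : R := 2 * upper_tail y - y * gauss_density y.

Lemma is_derive_marginal y :
  is_derive y (1 : R) marginal ((y ^+ 2 - 3) * gauss_density y).
Proof.
have D1 := is_deriveZ 2 (is_derive_upper_tail y).
have D2 := is_deriveM (is_derive_id y (1 : R)) (is_derive_gauss_density y).
apply: (is_derive_eq (is_deriveB D1 D2)).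
by rewrite /GRing.scale/=; ring.
Qed.

Definition objective y : R := y ^+ 2 * upper_tail y.

Lemma is_derive_objective y :
  is_derive y (1 : R) objective (y * marginal y).
Proof.
have -> : objective = (id : R -> R) * (id : R -> R) * upper_tail.
  by apply/funext => z; rewrite /objective expr2.
have D1 := is_derive_id y (1 : R).
apply: (is_derive_eq (is_deriveM (is_deriveM D1 D1) (is_derive_upper_tail y))).
by rewrite /marginal /GRing.scale/= !fctE; ring.
Qed.

Lemma upper_tail_ge0 y : 0 <= upper_tail y.
Proof. by rewrite fine_ge0// measure_ge0. Qed.

(* On [sqrt 3, +oo[ [marginal] is increasing, so a nonnegative value would keep
   [2 * upper_tail] away from 0 at infinity. *)
Lemma marginal_lt0_sqrt3 y : 0 <= y -> 3 <= y ^+ 2 -> marginal y < 0.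
Proof.
move=> y0 y3; rewrite ltNge; apply/negP => gy.
have incr a b : y <= a -> a < b -> marginal a < marginal b.
  move=> ya ab; apply: (lt_of_derive_gt0 _ _ _ _ is_derive_marginal ab).
  move=> x /andP[ax _].
  rewrite mulr_gt0 ?gauss_density_gt0// subr_gt0 (le_lt_trans y3)//.
  by rewrite ltr_pXn2r// ?nnegrE; lra.
have d0 : 0 < marginal (y + 1) by apply: (le_lt_trans gy); apply: incr; lra.
have /cvgrPdist_lt/(_ _ (divr_gt0 d0 (ltr0Sn _ 1)))[M [_ MN]] := cvg_Phi_oppr.
pose z := Num.max (M + 1) (y + 2).
have zM : M < z by rewrite lt_max ltrDl ltr01.
have yz : y + 2 <= z by rewrite le_max lexx orbT.
have := MN _ zM; rewrite sub0r normrN ger0_norm ?upper_tail_ge0// -/(upper_tail z).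
rewrite ltr_pdivlMr// mulrC.
have : marginal (y + 1) < marginal z by apply: incr; lra.
have : 0 <= z * gauss_density z.
  by rewrite mulr_ge0 ?(ltW (gauss_density_gt0 _))//; lra.
rewrite /marginal; lra.
Qed.

(** Below sqrt 3 [marginal] decreases strictly, so it is positive before its zero [y0] and negative
    after it; from sqrt 3 on, [marginal_lt0_sqrt3] gives the sign. Hence [objective] rises strictly
    up to [y0] and falls strictly afterwards. *)
Lemma objective_max y0 y : 0 < y0 -> y0 ^+ 2 < 3 -> marginal y0 = 0 ->
  0 < y -> y != y0 -> objective y < objective y0.
Proof.
move=> y00 y03 g0 yp.
have gl z : 0 < z -> z < y0 -> 0 < marginal z.
  move=> z0 zy; rewrite -g0 -ltrN2.
  apply: (lt_of_derive_gt0 _ _ _ _ (fun x => is_deriveN (is_derive_marginal x)) zy).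
  move=> x /andP[zx xy]; rewrite oppr_gt0 pmulr_llt0 ?gauss_density_gt0//.
  rewrite subr_lt0 (le_lt_trans _ y03)// ler_pXn2r ?nnegrE//; lra.
have gr z : y0 < z -> marginal z < 0.
  move=> yz; have [|z3] := leP 3 (z ^+ 2); first by apply: marginal_lt0_sqrt3; lra.
  rewrite -g0 -ltrN2.
  apply: (lt_of_derive_gt0 _ _ _ _ (fun x => is_deriveN (is_derive_marginal x)) yz).
  move=> x /andP[zx xy]; rewrite oppr_gt0 pmulr_llt0 ?gauss_density_gt0//.
  rewrite subr_lt0 (le_lt_trans _ z3)// ler_pXn2r ?nnegrE//; lra.
rewrite neq_lt => /orP[yy|yy].
  apply: (lt_of_derive_gt0 _ _ _ _ is_derive_objective yy) => x /andP[yx xy].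
  by rewrite mulr_gt0 ?gl//; lra.
rewrite -ltrN2.
apply: (lt_of_derive_gt0 _ _ _ _
  (fun x => is_deriveN (is_derive_objective x)) yy) => x /andP[yx xy].
by rewrite oppr_gt0 pmulr_rlt0 ?gr//; lra.
Qed.

(** * Rational enclosures and the critical point *)

(* 188 / 75 and 193 / 77 are close fractions enclosing sqrt (2 pi); terms are kept
   small because ring numerals are unary. *)
Lemma gauss_peak_bounds :
  75 / 188 < (gauss_peak : R) < 77 / 193.
Proof.
have /andP[p1 p2] := pi_bounds.
have s0 : 0 < Num.sqrt (pi *+ 2) :> R by rewrite sqrtr_gt0 pmulrn_lgt0 ?pi_gt0.
have E : Num.sqrt (pi *+ 2) ^+ 2 = pi *+ 2 :> R.
  by rewrite sqr_sqrtr// mulrn_wge0// pi_ge0.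
set s := Num.sqrt _ in s0 E *.
have s1 : s < 188 / 75 by rewrite -(ltr_pXn2r (n := 2)) ?nnegrE ?E//; lra.
have s2 : 193 / 77 < s by rewrite -(ltr_pXn2r (n := 2)) ?nnegrE ?E//; lra.
rewrite /gauss_peak -/s.
have -> : 75 / 188 = (188 / 75)^-1 :> R by field.
have -> : 77 / 193 = (193 / 77)^-1 :> R by field.
by rewrite !ltf_pV2 ?posrE ?s1//; lra.
Qed.

(* Primitive of [fun y => (expN_poly m).[y ^+ 2 / 2]] vanishing at 0. *)
Definition gauss_poly m : {poly R} :=
  \sum_(i < m) ((-1) ^+ i / (i`!%:R * 2 ^+ i * i.*2.+1%:R)) *: 'X^(i.*2.+1).

Lemma deriv_gauss_poly m y :
  (gauss_poly m)^`().[y] = (expN_poly m).[y ^+ 2 / 2].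
Proof.
have -> : (gauss_poly m)^`() =
    \sum_(i < m) ((-1) ^+ i / (i`!%:R * 2 ^+ i)) *: 'X^(i.*2).
  rewrite /gauss_poly raddf_sum; apply: eq_bigr => i _.
  rewrite [LHS]derivZ derivXn -scalerMnr scalerMnl -mulrnAr/=.
  have i1 : (i.*2.+1%:R)^-1 *+ i.*2.+1 = 1 :> R.
    by rewrite -[LHS]mulr_natr mulVf ?pnatr_eq0.
  by rewrite [in LHS]invfM -!mulrnAr i1 mulr1.
rewrite horner_sum /expN_poly horner_poly; apply: eq_bigr => i _.
by rewrite hornerZ hornerXn expr_div_n -exprM mul2n invfM; ring.
Qed.

(** All three expressions equal 1/2 at 0, and their derivatives compare by the bounds on exp(-t) at
    t = y^2 / 2. Seven terms overestimate the density, hence underestimate the tail; six terms do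
    the reverse. *)
Lemma upper_tail_bounds y : 0 <= y ->
  1 / 2 - gauss_peak * (gauss_poly 7).[y] <= upper_tail y <=
  1 / 2 - gauss_peak * (gauss_poly 6).[y].
Proof.
move=> y0; set c := gauss_peak.
have c0 : 0 <= c by rewrite invr_ge0.
have Dp m z : is_derive z (1 : R) (horner ((1 / 2)%:P - c *: gauss_poly m))
    (- (c * (expN_poly m).[z ^+ 2 / 2])).
  apply: is_derive_eq.
  by rewrite derivB derivC derivZ sub0r hornerN hornerZ deriv_gauss_poly.
have hE m : 1 / 2 - c * (gauss_poly m).[y] = ((1 / 2)%:P - c *: gauss_poly m).[y].
  by rewrite hornerD hornerN hornerC hornerZ.
have p0 m : ((1 / 2)%:P - c *: gauss_poly m).[0] = 1 / 2.
  rewrite hornerD hornerN hornerC hornerZ /gauss_poly horner_sum big1 ?mulr0 ?subr0//.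
  by move=> i _; rewrite hornerZ hornerXn expr0n mulr0.
have t0 : upper_tail 0 = 1 / 2 :> R by rewrite /upper_tail oppr0 Phi0.
rewrite !hE; apply/andP; split.
  apply: (le_of_le_derive _ _ _ _ (Dp 7) is_derive_upper_tail) => //.
    by rewrite p0 t0.
  move=> z z0; rewrite lerN2 ler_wpM2l//.
  by have /andP[_] := expN_poly_bounds 3 (z ^+ 2 / 2 : R) ltac:(nra).
apply: (le_of_le_derive _ _ _ _ is_derive_upper_tail (Dp 6)) => //.
  by rewrite p0 t0.
move=> z z0; rewrite lerN2 ler_wpM2l//.
by have /andP[] := expN_poly_bounds 3 (z ^+ 2 / 2 : R) ltac:(nra).
Qed.

Lemma gauss_density_bounds y : 0 <= y ->
  gauss_peak * (expN_poly 6).[y ^+ 2 / 2] <= gauss_density y <=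
  gauss_peak * (expN_poly 7).[y ^+ 2 / 2].
Proof.
move=> y0; set c := gauss_peak; have c0 : 0 <= c by rewrite invr_ge0.
have /andP[? ?] := expN_poly_bounds 3 (y ^+ 2 / 2 : R) ltac:(nra).
by rewrite !ler_wpM2l.
Qed.

Lemma horner_expN_poly6 x : (expN_poly 6).[x] =
  1 - x + x ^+ 2 / 2 - x ^+ 3 / 6 + x ^+ 4 / 24 - x ^+ 5 / 120.
Proof.
rewrite /expN_poly horner_poly !big_ord_recr big_ord0/=.
have [-> -> -> -> ->] :
  [/\ 1`! = 1, 2`! = 2, 3`! = 6, 4`! = 24 & 5`! = 120]%N by [].
by rewrite fact0; field.
Qed.

Lemma horner_expN_poly7 x :
  (expN_poly 7).[x] = (expN_poly 6).[x] + x ^+ 6 / 720.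
Proof.
rewrite /expN_poly !horner_poly big_ord_recr/=; congr (_ + _).
by rewrite (_ : 6`! = 720)%N//; field.
Qed.

Lemma horner_gauss_poly6 x : (gauss_poly 6).[x] =
  x - x ^+ 3 / 6 + x ^+ 5 / 40 - x ^+ 7 / 336 + x ^+ 9 / (24 * 16 * 9)
  - x ^+ 11 / (120 * 32 * 11).
Proof.
rewrite /gauss_poly horner_sum !big_ord_recr big_ord0/= !(hornerZ, hornerXn).
have [-> -> -> -> ->] :
  [/\ 1`! = 1, 2`! = 2, 3`! = 6, 4`! = 24 & 5`! = 120]%N by [].
by rewrite !doubleS double0 fact0; field.
Qed.

Lemma horner_gauss_poly7 x :
  (gauss_poly 7).[x] = (gauss_poly 6).[x] + x ^+ 13 / (720 * 64 * 13).
Proof.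
rewrite /gauss_poly big_ord_recr/= hornerD hornerZ hornerXn; congr (_ + _).
by rewrite !doubleS double0 (_ : 6`! = 720)%N//; field.
Qed.

(** The fractions 44/37 and 56/47 enclose the zero of [marginal] tightly enough for all three
    roundings. Here the tail is bounded from below and the density from above; at 56/47 it is the
    other way round. *)
Lemma marginal_gt0_44_37 : 0 < marginal (44 / 37 : R).
Proof.
have /andP[c1 c2] := gauss_peak_bounds.
have /andP[N1 _] := upper_tail_bounds (44 / 37) ltac:(lra).
have /andP[_ D2] := gauss_density_bounds (44 / 37) ltac:(lra).
rewrite /marginal; move: N1 D2.
rewrite horner_gauss_poly7 horner_gauss_poly6 horner_expN_poly7 horner_expN_poly6.
lra.
Qed.

Lemma marginal_lt0_56_47 : marginal (56 / 47 : R) < 0.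
Proof.
have /andP[c1 c2] := gauss_peak_bounds.
have /andP[_ N2] := upper_tail_bounds (56 / 47) ltac:(lra).
have /andP[D1 _] := gauss_density_bounds (56 / 47) ltac:(lra).
rewrite /marginal; move: N2 D1.
rewrite horner_gauss_poly6 horner_expN_poly6.
lra.
Qed.

(** The derivative of y phi(y) is (1 - y^2) phi(y). This transfers the enclosure of the critical
    point to the acceptance rate. *)
Lemma mul_gauss_density_decr x y : 1 <= x -> x < y ->
  y * gauss_density y < x * gauss_density x.
Proof.
move=> x1 xy; rewrite -ltrN2.
have D z : is_derive z (1 : R) (- ((id : R -> R) * gauss_density))
    ((z ^+ 2 - 1) * gauss_density z).
  apply: (is_derive_eq (is_deriveN (is_deriveM (is_derive_id z (1 : R))
    (is_derive_gauss_density z)))).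
  by rewrite /GRing.scale/=; ring.
apply: (lt_of_derive_gt0 _ _ _ _ D xy) => z /andP[xz zy].
rewrite mulr_gt0 ?gauss_density_gt0//; nra.
Qed.

(** The zero comes from the intermediate value theorem. There y0 phi(y0) equals 2 Phi(-y0), the
    acceptance rate, and the last number is the acceleration factor after the substitution l = 2 y0
    / sqrt (Sigma : Lambda). *)
Lemma critical_point : exists y0 : R, [/\ 0 < y0, y0 ^+ 2 < 3,
  marginal y0 = 0, rounds_to 2 (2 * y0) (238 / 100) &
  rounds_to 3 (y0 * gauss_density y0) (234 / 1000) /\
  rounds_to 2 (2 * y0 ^+ 2 * (y0 * gauss_density y0)) (66 / 100)].
Proof.
have cm : {within `[44 / 37, 56 / 47], continuous marginal}.
  apply: derivable_within_continuous => z _.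
  exact: (@ex_derive _ _ _ _ _ _ _ (is_derive_marginal z)).
have le : 44 / 37 <= 56 / 47 :> R by lra.
have m1 := marginal_gt0_44_37; have m2 := marginal_lt0_56_47.
have [|y0] := IVT (v := 0) le cm.
  by rewrite ge_min (ltW m2) orbT le_max (ltW m1).
rewrite in_itv/= => /andP[l u] my0.
have l' : 44 / 37 < y0.
  rewrite lt_neqAle l andbT; apply: contraPneq my0 => <-.
  by apply/eqP; rewrite gt_eqF.
have u' : y0 < 56 / 47.
  rewrite lt_neqAle u andbT; apply: contraPneq my0 => ->.
  by apply/eqP; rewrite lt_eqF.
have /andP[c1 c2] := gauss_peak_bounds.
(* The rounding to 0.234 would allow values up to 0.2345, but then the bound 0.665 on the last
   product could fail near 56/47; hence the sharper 0.2341. *)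
have al : y0 * gauss_density y0 < 2341 / 10 / 1000.
  apply: (lt_trans (mul_gauss_density_decr (44 / 37) y0 ltac:(lra) l')).
  have /andP[_] := gauss_density_bounds (44 / 37) ltac:(lra).
  rewrite horner_expN_poly7 horner_expN_poly6; lra.
have au : 2336 / 10 / 1000 < y0 * gauss_density y0.
  apply: (lt_trans _ (mul_gauss_density_decr y0 (56 / 47) ltac:(lra) u')).
  have /andP[+ _] := gauss_density_bounds (56 / 47) ltac:(lra).
  rewrite horner_expN_poly6; lra.
exists y0; rewrite /rounds_to; split.
- by lra.
- by nra.
- exact: my0.
- by rewrite ltr_norml; lra.
split; first by rewrite ltr_norml; lra.
have y2l : (44 / 37) ^+ 2 < y0 ^+ 2 by nra.
have y2u : y0 ^+ 2 < (56 / 47) ^+ 2 by nra.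
by rewrite ltr_norml; nra.
Qed.

End scalar_problem.

(** * Nondegeneracy of the score *)

Section nondegeneracy.
Local Open Scope classical_set_scope.
Local Open Scope ring_scope.

(** * Translation invariance of Lebesgue measure *)

Section translation.
Context {R : realType}.

Lemma measurable_addr (h : R) :
  measurable_fun [set: measurableTypeR R]
    (fun x : measurableTypeR R => x + h : measurableTypeR R).
Proof. exact: measurable_funD. Qed.

(** Lebesgue measure is determined by its values on half-open intervals, whose lengths a translation
    preserves. *)
Lemma lebesgue_measure_shift (h : R) (A : set (measurableTypeR R)) :
  measurable A ->
  lebesgue_measure ((fun x => x + h) @^-1` A) = lebesgue_measure A.
Proof.
move=> mA; apply/esym.
pose f := (fun x : measurableTypeR R => x + h : measurableTypeR R).
have mf : measurable_fun setT f by exact: measurable_addr.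
pose mf' := isMeasurableFun.Build _ _ _ _ f mf.
pose F : {mfun measurableTypeR R >-> measurableTypeR R} := HB.pack f mf'.
suff H : forall X, ocitv X ->
    lebesgue_measure X = pushforward lebesgue_measure F X.
  exact: (@lebesgue_measure_unique R (pushforward lebesgue_measure F) H A mA).
move=> X [[a b] _ <-].
rewrite /pushforward /= (_ : f @^-1` _ = `]a - h, b - h]%classic).
  rewrite !lebesgue_measure_itv/= !lte_fin ltrD2r.
  by case: ifP => // _; rewrite -!EFinD; congr (_%:E); ring.
by apply/seteqP; split => x; rewrite /= /f !in_itv/= ltrBlDr lerBrDr.
Qed.

Lemma measurable_rV_add n (h : 'rV[R]_n) :
  measurable_fun [set: 'rV[R]_n] (fun v => v + h).
Proof.
apply: measurable_fun_rVP => i.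
rewrite (_ : _ \o _ = (fun x : measurableTypeR R =>
    x + h ord0 i : measurableTypeR R) \o rV_coord i).
  apply: measurableT_comp; [exact: measurable_addr|exact: measurable_rV_coord].
by apply/funext => v; rewrite /= /rV_coord mxE.
Qed.

(** By induction on the dimension: through [rV_cons] the translation acts separately on the first
    coordinate and on the rest. The translated product measure thus has the right values on
    rectangles, which determine it. *)
Lemma lebesgue_rV_shift n (h : 'rV[R]_n) (A : set 'rV[R]_n) :
  measurable A -> lebesgue_rV R n ((fun v => v + h) @^-1` A) = lebesgue_rV R n A.
Proof.
elim: n h A => [|n IHn] h A mA.
  congr (lebesgue_rV R 0 _); apply/seteqP; split => v /=;
  by rewrite (_ : v + h = v)//; apply/rowP => -[].
pose h' : 'rV[R]_n := \row_j h ord0 (lift ord0 j).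
pose T (p : measurableTypeR R * 'rV[R]_n) : measurableTypeR R * 'rV[R]_n :=
  (p.1 + h ord0 ord0 : measurableTypeR R, p.2 + h').
have mT : measurable_fun setT T.
  apply/measurable_fun_pairP; split.
    exact: measurableT_comp (measurable_addr _) measurable_fst.
  exact: measurableT_comp (measurable_rV_add _ _) measurable_snd.
pose mT' := isMeasurableFun.Build _ _ _ _ T mT.
pose F : {mfun (measurableTypeR R * 'rV[R]_n)%type >->
    (measurableTypeR R * 'rV[R]_n)%type} := HB.pack T mT'.
have TE : (fun v => v + h) \o @rV_cons R n = @rV_cons R n \o T.
  apply/funext => -[x v]; apply/rowP => i; rewrite !mxE/=.
  by case: unliftP => [j ->|->] /=; rewrite ?mxE.
rewrite /= /lebesgue_rV_step /pushforward -comp_preimage TE comp_preimage.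
apply/esym.
apply: (@product_measure_unique _ _ _ _ R lebesgue_measure (lebesgue_rV R n)
   (pushforward (lebesgue_measure \x lebesgue_rV R n)%E F)).
  move=> B C mB mC.
  transitivity ((lebesgue_measure \x lebesgue_rV R n)%E
      (((fun x => x + h ord0 ord0) @^-1` B) `*` ((fun v => v + h') @^-1` C))).
    by congr product_measure1; apply/seteqP; split => -[].
  rewrite product_measure1E ?IHn//.
  - by congr (_ * _)%E; exact: lebesgue_measure_shift.
  - by rewrite -[X in measurable X]setTI; exact: measurable_addr.
  - by rewrite -[X in measurable X]setTI; exact: measurable_rV_add.
by rewrite -[X in measurable X]setTI; exact: measurable_rV_cons.
Qed.

Lemma ge0_integral_lebesgue_rV_shift n (h : 'rV[R]_n) (f : 'rV[R]_n -> \bar R) :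
  measurable_fun setT f -> (forall v, 0 <= f v)%E ->
  (\int[lebesgue_rV R n]_v f (v + h)%R = \int[lebesgue_rV R n]_v f v)%E.
Proof.
move=> mf f0.
pose mT' := isMeasurableFun.Build _ _ _ _ (fun v : 'rV[R]_n => v + h)
  (measurable_rV_add n h).
pose F : {mfun 'rV[R]_n >-> 'rV[R]_n} := HB.pack (fun v => v + h) mT'.
have := @ge0_integral_pushforward _ _ _ _ R F (measurable_rV_add n h)
  (lebesgue_rV R n) setT f measurableT mf (fun v _ => f0 v).
rewrite preimage_setT => <-.
apply: eq_measure_integral => A mA _.
by have := lebesgue_rV_shift n h A mA.
Qed.

End translation.

(** The formula for [nu] makes it absolutely continuous, and [g] has the same integral over every
    measurable set as the Radon-Nikodym derivative, so the two agree almost everywhere. The change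
    of variables for that derivative then passes to [g]. *)
Lemma ge0_integral_density (R : realType) d (T : measurableType d)
    (mu : {sigma_finite_measure set T -> \bar R})
    (nu : {finite_measure set T -> \bar R}) (g : T -> R) (f : T -> \bar R) :
  measurable_fun setT g -> (forall x, 0 <= g x) ->
  (forall A, measurable A -> nu A = (\int[mu]_(x in A) (g x)%:E)%E) ->
  measurable_fun setT f -> (forall x, (0 <= f x)%E) ->
  (\int[nu]_x f x = \int[mu]_x (f x * (g x)%:E))%E.
Proof.
move=> mg g0 nuE mf f0.
have mg' : measurable_fun setT (EFin \o g) by exact/measurable_EFinP.
have dom : nu `<< mu.
  apply/null_content_dominatesP => A mA muA0; rewrite nuE//.
  by apply: null_set_integral => //; exact: measurable_funTS.
rewrite -(Radon_Nikodym_SigmaFinite.change_of_variables dom)//.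
have iRN := Radon_Nikodym_SigmaFinite.f_integrable dom.
have mRN := measurable_int _ iRN.
apply: ge0_ae_eq_integral => //.
- exact: emeasurable_funM.
- exact: emeasurable_funM.
- by move=> x _; rewrite mule_ge0// Radon_Nikodym_SigmaFinite.f_ge0.
- by move=> x _; rewrite mule_ge0// lee_fin.
apply: ae_eqe_mul2l; apply: integral_ae_eq => //.
by move=> E _ mE; rewrite -Radon_Nikodym_SigmaFinite.f_integral// nuE.
Qed.

(** * Directional derivatives *)

Section line.
Context {R : realType} {V W : normedModType R}.

Lemma is_derive_line (f : V -> W) (x v : V) (t : R) :
  differentiable f (x + t *: v) ->
  is_derive t (1 : R) (fun s => f (x + s *: v)) ('D_v f (x + t *: v)).
Proof.
move=> df; have dv : derivable f (x + t *: v) v by exact: diff_derivable.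
have E : (fun h : R => h^-1 *:
      (((fun s => f (x + s *: v)) \o shift t) (h *: 1) - f (x + t *: v))) =
    (fun h : R => h^-1 *:
      ((f \o shift (x + t *: v)) (h *: v) - f (x + t *: v))).
  apply/funext => h /=; congr (_ *: (f _ - _)).
  by rewrite [h *: 1]mulr1 scalerDl addrCA.
by split; rewrite /derivable /derive E.
Qed.
End line.

Section difference_quotient.
Context {R : realType}.

(** A pointwise limit of the measurable difference quotients with steps 1 / (m + 1). *)
Lemma measurable_derive n (f : 'rV[R]_n -> R) (v : 'rV[R]_n) :
  measurable_fun setT f -> (forall x, derivable f x v) ->
  measurable_fun setT (fun x => 'D_v f x).
Proof.
move=> mf dfv.
pose q (m : nat) (x : 'rV[R]_n) := m.+1%:R * (f (x + m.+1%:R^-1 *: v) - f x).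
apply: (@measurable_fun_cvg _ _ _ _ q) => [m|x _].
  apply: measurable_funM => //; apply: measurable_funB => //.
  exact: measurableT_comp mf (measurable_rV_add _ _).
have /cvgr_dnbhsP/(_ (@harmonic R)) :
    (fun h => h^-1 *: ((f \o shift x) (h *: v) - f x)) h @[h --> 0^']
    --> 'D_v f x.
  exact: dfv.
have hn0 m : @harmonic R m != 0 by rewrite /harmonic invr_eq0.
move=> /(_ (conj hn0 cvg_harmonic)).
apply: cvg_trans; apply: near_eq_cvg; apply: nearW => m.
by rewrite /q /harmonic/= invrK [_ *: v + x]addrC.
Qed.
End difference_quotient.

(** * Growth of the density and square integrability of the score *)

Section score.
Context {R : realType} (k : nat) (pi : 'rV[R]_k -> R).
Hypothesis (mpi : measurable_fun setT pi) (pi_gt0 : forall x, 0 < pi x).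
Hypothesis dpi : forall x, differentiable (log_density pi) x.
Hypothesis lpi : lipschitz (score pi).
Local Notation e_ i := (delta_mx ord0 i : 'rV[R]_k).

Lemma scoreE x i : score pi x ord0 i = 'D_(e_ i) (log_density pi) x.
Proof. by rewrite mxE. Qed.

Lemma measurable_score i : measurable_fun setT (fun x => score pi x ord0 i).
Proof.
rewrite (_ : (fun x => _) = (fun x => 'D_(e_ i) (log_density pi) x)); last first.
  by apply/funext => x; exact: scoreE.
apply: measurable_derive => [|x]; last exact: diff_derivable.
exact: measurableT_comp mpi.
Qed.

Lemma mx_entry_le_norm m n (A : 'M[R]_(m, n)) i j : `|A i j| <= `|A|.
Proof.
rewrite [leRHS]/Num.norm/= mx_normrE.
exact: (le_bigmax _ (fun ij => `|A ij.1 ij.2|) (i, j)).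
Qed.

Lemma score_lipschitz : exists2 M : R, 0 <= M & forall x y i,
  `|score pi x ord0 i - score pi y ord0 i| <= M * `|x - y|.
Proof.
have [M [_ MP]] := lpi.
exists (Num.max M 0 + 1); first by rewrite addr_ge0// le_max lexx orbT.
move=> x y i.
have /MP /(_ (x, y) (conj I I)) /= : M < Num.max M 0 + 1.
  by rewrite (@le_lt_trans _ _ (Num.max M 0)) ?le_max ?lexx// ltrDl.
apply: le_trans; rewrite /self_sub/=.
by have := mx_entry_le_norm _ _ (score pi x - score pi y) ord0 i; rewrite !mxE.
Qed.

Lemma log_density_line x i (t : R) :
  is_derive t (1 : R) (fun s => log_density pi (x + s *: e_ i))
    (score pi (x + t *: e_ i) ord0 i).
Proof. by rewrite scoreE; exact: is_derive_line. Qed.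

(** By the mean value theorem, log pi changes along a unit step by plus or minus the score at an
    intermediate point, and the Lipschitz condition compares that value with the score at [x]. *)
Lemma density_shift_ge : exists K : R, forall x i,
  pi x * expR (score pi x ord0 i - K) <= pi (x + e_ i) /\
  pi x * expR (- score pi x ord0 i - K) <= pi (x - e_ i).
Proof.
have [M M0 MP] := score_lipschitz.
(* Summing the norms of all basis vectors gives one constant for every direction. *)
exists (M * \sum_i `|e_ i|) => x i.
have lip t : -1 <= t <= 1 ->
    `|score pi (x + t *: e_ i) ord0 i - score pi x ord0 i| <=
    M * \sum_i `|e_ i|.
  move=> t1; apply: (le_trans (MP _ _ _)); rewrite addrAC subrr add0r.
  rewrite ler_wpM2l// normrZ (bigD1 i)//= (@le_trans _ _ `|e_ i|)//.
    by rewrite ler_piMl// ler_norml.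
  by rewrite lerDl sumr_ge0.
have cont a b :
    {within `[a, b], continuous (fun s => log_density pi (x + s *: e_ i))}.
  apply: derivable_within_continuous => t _.
  exact: (@ex_derive _ _ _ _ _ _ _ (log_density_line x i t)).
have piE y : pi y = expR (log_density pi y) by rewrite lnK// posrE.
split.
  have [t] := MVT (ltr01 : 0 < 1 :> R) (fun t _ => log_density_line x i t)
    (cont _ _).
  rewrite in_itv/= => /andP[t0 t1].
  rewrite scale1r scale0r addr0 subr0 mulr1 => E.
  rewrite (piE x) (piE (x + _)) -expRD ler_expR.
  by have := lip t ltac:(lra); rewrite ler_norml; lra.
have [t] := MVT (ltrN10 R) (fun t _ => log_density_line x i t) (cont _ _).
rewrite in_itv/= => /andP[t0 t1].
rewrite scaleN1r scale0r addr0 sub0r opprK mulr1 => E.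
rewrite (piE x) (piE (x - _)) -expRD ler_expR.
by have := lip t ltac:(lra); rewrite ler_norml; lra.
Qed.
End score.

(** Whichever of [s] and [-s] is nonnegative already has a large enough exponential. This turns the
    two bounds of [density_shift_ge] into a second-moment bound. *)
Lemma half_sqr_le_expRD (R : realType) (s : R) :
  s ^+ 2 / 2 <= expR s + expR (- s).
Proof.
have H (t : R) : 0 <= t -> t ^+ 2 / 2 <= expR t.
  by move=> t0; have := @expR_ge1Dxn R t 1 t0; rewrite (_ : 2`! = 2)%N//; lra.
have [s0|/ltW s0] := leP 0 s.
  by have := H _ s0; have := expR_ge0 (- s); lra.
have := H (- s); rewrite oppr_ge0 sqrrN => /(_ s0).
by have := expR_ge0 s; lra.
Qed.

Section L2.
Context {R : realType} (k : nat) (P : probability 'rV[R]_k R).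
Variable pi : 'rV[R]_k -> R.
Hypothesis (dP : has_density P pi) (pi_gt0 : forall x, 0 < pi x).
Hypothesis dpi : forall x, differentiable (log_density pi) x.
Hypothesis lpi : lipschitz (score pi).
Local Notation e_ i := (delta_mx ord0 i : 'rV[R]_k).
Local Notation mu := (lebesgue_rV R k).

Let mpi : measurable_fun setT pi. Proof. by case: dP. Qed.
Let mpiE : measurable_fun setT (EFin \o pi).
Proof. exact/measurable_EFinP. Qed.

Lemma integral_density_shift (h : 'rV[R]_k) :
  (\int[mu]_x (pi (x + h))%:E = 1)%E.
Proof.
rewrite (ge0_integral_lebesgue_rV_shift _ h (EFin \o pi))//=.
  by have [_ _ <-//] := dP; exact: probability_setT.
by move=> x; rewrite lee_fin ltW.
Qed.

Lemma integral_probE (f : 'rV[R]_k -> \bar R) :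
  measurable_fun setT f -> (forall x, 0 <= f x)%E ->
  (\int[P]_x f x = \int[mu]_x (f x * (pi x)%:E))%E.
Proof.
have [_ pi0 PE] := dP.
exact: ge0_integral_density.
Qed.

Lemma score_sqr_integral_lty i :
  (\int[P]_x ((score pi x ord0 i) ^+ 2)%:E < +oo)%E.
Proof.
have [K HK] := density_shift_ge _ _ pi_gt0 dpi lpi.
have ms := measurable_score _ _ mpi dpi i.
have ms2 : measurable_fun setT (fun x => ((score pi x ord0 i) ^+ 2)%:E).
  exact/measurable_EFinP/measurable_funX.
have mshift (h : 'rV[R]_k) :
    measurable_fun setT (fun x : 'rV[R]_k => (pi (x + h))%:E).
  exact: measurableT_comp mpiE (measurable_rV_add _ _).
rewrite integral_probE//; last by move=> x; rewrite lee_fin sqr_ge0.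
apply: (@le_lt_trans _ _ (\int[mu]_x
    ((2 * expR K)%:E * ((pi (x + e_ i))%:E + (pi (x - e_ i))%:E)))%E).
  apply: ge0_le_integral => //.
  - by move=> x _; rewrite mule_ge0// lee_fin ?sqr_ge0// ltW.
  - exact: emeasurable_funM.
  - by apply: emeasurable_funM => //; exact: emeasurable_funD.
  move=> x _; rewrite -EFinM -EFinD -EFinM lee_fin.
  have [] := HK x i; rewrite !expRD expRN => H1 H2.
  set s := score pi x ord0 i in H1 H2 *.
  have eK : 0 < expR K by exact: expR_gt0.
  have H1' : pi x * expR s <= expR K * pi (x + e_ i).
    by rewrite -ler_pdivrMl// mulrC -mulrA.
  have H2' : pi x * expR (- s) <= expR K * pi (x - e_ i).
    by rewrite -ler_pdivrMl// mulrC -mulrA.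
  have H3 := ler_wpM2l (ltW (pi_gt0 x)) (half_sqr_le_expRD R s).
  move: H3; rewrite mulrDr mulrA; lra.
rewrite ge0_integralZl//.
- rewrite ge0_integralD//.
  + by rewrite !integral_density_shift -EFinD -EFinM ltry.
  + by move=> x _; rewrite lee_fin ltW.
  + by move=> x _; rewrite lee_fin ltW.
- exact: emeasurable_funD.
- by move=> x _; rewrite adde_ge0// lee_fin ltW.
Qed.

Lemma score_centered_integrable i j (a b : R) :
  P.-integrable setT
    (fun x => ((score pi x ord0 i - a) * (score pi x ord0 j - b))%:E).
Proof.
have ms l := measurable_score _ _ mpi dpi l.
have msc l c : measurable_fun setT (fun x => score pi x ord0 l - c).
  by apply: measurable_funB.
have isq l : P.-integrable setT (fun x => ((score pi x ord0 l) ^+ 2)%:E).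
  apply/integrableP; split; first exact/measurable_EFinP/measurable_funX.
  under eq_integral do rewrite gee0_abs ?lee_fin ?sqr_ge0//.
  exact: score_sqr_integral_lty.
have icst (c : R) : P.-integrable setT (fun x => c%:E).
  exact: finite_measure_integrable_cst.
have I : P.-integrable setT (fun x => ((score pi x ord0 i) ^+ 2)%:E +
    ((a ^+ 2 + b ^+ 2)%:E + ((score pi x ord0 j) ^+ 2)%:E))%E.
  by apply: integrableD => //; apply: integrableD.
have I2 := integrableZl measurableT 2 I.
apply: le_integrable I2 => //.
  by apply/measurable_EFinP; apply: measurable_funM.
move=> x _ /=; rewrite -?EFinD -?EFinM ?lee_fin.
set s := score _ _ _ _; set t := score _ _ _ _.
have H : 0 <= 2 * (s ^+ 2 + (a ^+ 2 + b ^+ 2 + t ^+ 2)).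
  by rewrite mulr_ge0 ?addr_ge0 ?sqr_ge0.
rewrite (ger0_norm H) ler_norml.
(* The squares of (s - a) - (t - b) and (s - a) + (t - b) bound the product by the half-sum of (s -
   a)^2 and (t - b)^2; those of s + a and t + b bound these by 2 (s^2 + a^2) and 2 (t^2 + b^2). *)
have := sqr_ge0 (s + a); have := sqr_ge0 (t + b).
have := sqr_ge0 ((s - a) - (t - b)); have := sqr_ge0 ((s - a) + (t - b)).
lra.
Qed.
End L2.

(** * Positivity of Sigma : Lambda *)

Lemma lebesgue_rV_box_gt0 (R : realType) k (x : 'rV[R]_k) (r : R) : 0 < r ->
  exists B : set 'rV[R]_k, [/\ measurable B, (0 < lebesgue_rV R k B)%E &
    forall y, B y -> `|x - y| <= r].
Proof.
move=> r0; pose A i : set (measurableTypeR R) := ball (x ord0 i) r.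
have mA i : measurable (A i) by exact: measurable_ball.
exists [set v | forall i, A i (rV_coord i v)]; split.
- rewrite (_ : mkset _ = \bigcap_(i in [set: 'I_k]) (rV_coord i @^-1` A i));
    last first.
    by apply/seteqP; split => y /= H i; [move=> _|]; exact: H.
  apply: fin_bigcap_measurable => // i _.
  by rewrite -[X in measurable X]setTI; exact: measurable_rV_coord.
- rewrite lebesgue_rV_box//.
  apply: (big_ind (fun z => 0 < z)%E) => //.
    by move=> ? ? ? ?; exact: mule_gt0.
  by move=> i _; rewrite lebesgue_measure_ball ?(ltW r0)// lte_fin pmulrn_lgt0.
(* The norm of a row vector is its largest absolute entry, so the box stays within distance [r] of
   its centre. *)
move=> y yB; rewrite [leLHS]/Num.norm/= mx_normrE.
apply/bigmax_leP; split => [|[i j] _]; first exact: ltW.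
by rewrite /= ord1 !mxE ltW//; have := yB j; rewrite /A /ball/=.
Qed.

Section nondegenerate.
Context {R : realType} (k : nat) (P : probability 'rV[R]_k R).
Variable pi : 'rV[R]_k -> R.
Hypothesis (dP : has_density P pi) (pi_gt0 : forall x, 0 < pi x).
Hypothesis dpi : forall x, differentiable (log_density pi) x.
Hypothesis lpi : lipschitz (score pi).
Local Notation e_ i := (delta_mx ord0 i : 'rV[R]_k).
Local Notation mu := (lebesgue_rV R k).

Let mpi : measurable_fun setT pi. Proof. by case: dP. Qed.
Let mpiE : measurable_fun setT (EFin \o pi).
Proof. exact/measurable_EFinP. Qed.

Lemma density_null_lebesgue_null (U : set 'rV[R]_k) :
  measurable U -> P U = 0%E -> mu U = 0%E.
Proof.
move=> mU; have [_ _ ->//] := dP => U0.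
have := @ae_eq_integral_abs _ _ R mu U mU (EFin \o pi) (measurable_funTS mpiE).
under eq_integral do rewrite /= ger0_norm ?(ltW (pi_gt0 _))//.
move=> [/(_ U0) [N [mN N0 UN]] _].
apply/eqP; rewrite eq_le measure_ge0 andbT -N0.
apply: le_measure; rewrite ?inE// => x Ux; apply: UN => /= /(_ Ux) /eqP.
by rewrite eqe gt_eqF.
Qed.

(** A value other than [c] at one point would persist, by the Lipschitz bound, on a box of positive
    Lebesgue measure, whereas a [P]-null set is Lebesgue null because pi is positive. *)
Lemma score_cst_everywhere i (c : R) :
  P [set x | score pi x ord0 i != c] = 0%E -> forall x, score pi x ord0 i = c.
Proof.
have ms := measurable_score _ _ mpi dpi i.
have mU : measurable [set x | score pi x ord0 i != c].
  rewrite (_ : mkset _ = (fun x => score pi x ord0 i) @^-1` (~` [set c])).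
    by rewrite -[X in measurable X]setTI; apply: ms => //; exact: measurableC.
  by apply/seteqP; split => x /= /eqP.
move=> /(density_null_lebesgue_null _ mU) U0 x; apply/eqP/negP => /negP xc.
have [M M0 MP] := score_lipschitz _ _ lpi.
pose d := `|score pi x ord0 i - c|.
have d0 : 0 < d by rewrite normr_gt0 subr_eq0.
have M1 : 0 < M + 1 by lra.
(* With radius d / (M + 1) the score moves by at most M d / (M + 1) < d, also when [M] is 0. *)
have [B [mB B0 BP]] := lebesgue_rV_box_gt0 _ _ x _ (divr_gt0 d0 M1).
suff : (mu B <= 0)%E by rewrite leNgt B0.
rewrite -U0; apply: le_measure; rewrite ?inE// => y By /=.
apply/eqP => yc; have := MP x y i; rewrite yc -/d leNgt => /negP; apply.
apply: (@le_lt_trans _ _ (M * (d / (M + 1)))); first by rewrite ler_wpM2l// BP.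
by rewrite mulrA ltr_pdivrMr// mulrC ltr_pM2l//; lra.
Qed.

Lemma score_not_cst i (c : R) : ~ (forall x, score pi x ord0 i = c).
Proof.
move=> sc.
have piE y : pi y = expR (log_density pi y) by rewrite lnK// posrE.
have shift x t : pi (x + t *: e_ i) = expR (t * c) * pi x.
  pose f (s : R) := log_density pi (x + s *: e_ i) - s * c.
  have Df s : is_derive s (1 : R) f 0.
    have D2 : is_derive s (1 : R) (fun z : R => z * c) c.
      apply: (is_derive_eq (is_deriveM (is_derive_id s (1 : R))
        (is_derive_cst c s (1 : R)))).
      by rewrite scaler0 add0r [_ *: _]mulr1.
    apply: (is_derive_eq (is_deriveB (log_density_line _ _ dpi x i s) D2)).
    by rewrite sc subrr.
  have := is_derive_0_is_cst t 0 Df; rewrite /f scale0r addr0 mul0r subr0 => E.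
  by rewrite !piE -expRD -E [_ + (_ - _)]addrC subrK.
(* Integrating the shift identity at t = 1 gives exp c = 1. *)
have c0 : c = 0.
  have /eqP := integral_density_shift _ _ _ dP pi_gt0 (e_ i).
  under eq_integral => x _ do rewrite -[e_ i]scale1r shift mul1r EFinM.
  rewrite ge0_integralZl//; last by move=> x _; rewrite lee_fin ltW.
  have -> : (\int[mu]_x (pi x)%:E = 1)%E.
    by have [_ _ <-//] := dP; exact: probability_setT.
  rewrite mule1 eqe -expR0 => /eqP; exact: expR_inj.
pose X0 : 'rV[R]_k -> R := fun v => v ord0 i.
have mX0 : measurable_fun setT X0 by exact: (measurable_rV_coord i).
pose X0' := isMeasurableFun.Build _ _ _ _ X0 mX0.
pose X : {RV P >-> R} := HB.pack X0 X0'.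
have mA t : measurable (X0 @^-1` `]-oo, t]).
  by rewrite -[X in measurable X]setTI; exact: (mX0 measurableT).
(* Now pi is invariant along [e_ i], and translating by t along [e_ i] carries the event X <= 0 to
   the event X <= t, so both have the same probability. *)
have cdfE t : cdf X t = cdf X 0.
  rewrite /cdf /distribution /pushforward /=.
  have AE s : P (X0 @^-1` `]-oo, s]) =
      (\int[mu]_x ((\1_(X0 @^-1` `]-oo, s]) x)%:E * (pi x)%:E))%E.
    rewrite -[X in P X]setIT -integral_indic//.
    rewrite (integral_probE _ _ _ dP)//.
    exact/measurable_EFinP/measurable_indic.
  rewrite !AE -(ge0_integral_lebesgue_rV_shift _ (t *: e_ i)
    (fun x => (\1_(X0 @^-1` `]-oo, t]) x)%:E * (pi x)%:E)%E)//.
  - apply: eq_integral => x _; rewrite shift c0 mulr0 expR0 mul1r.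
    congr ((_ : R)%:E * _)%E; rewrite !indicE; congr (_%:R); congr nat_of_bool.
    apply/idP/idP; rewrite !inE /= !in_itv/= /X0 !mxE !eqxx mulr1; lra.
  - apply: emeasurable_funM => //; exact/measurable_EFinP/measurable_indic.
  - by move=> v; rewrite mule_ge0// lee_fin// ltW.
have H1 := @cvg_cdfy1 _ _ _ _ X; have H0 := @cvg_cdfNy0 _ _ _ _ X.
have E : cdf X = cst (cdf X 0) by apply/funext => t; rewrite /= cdfE.
have E1 : cdf X 0 = 1%E.
  by apply: (cvg_unique _ _ H1) => //; rewrite E; exact: cvg_cst.
have E0 : cdf X 0 = 0%E.
  by apply: (cvg_unique _ _ H0) => //; rewrite E; exact: cvg_cst.
by have := @oner_neq0 R; rewrite -(inj_eq (@EFin_inj R)) -E1 E0 eqxx.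
Qed.

Lemma posdef_ge0 (Lam : 'M[R]_k) (u : 'rV[R]_k) : sym_posdef Lam ->
  0 <= (u *m Lam *m u^T) ord0 ord0.
Proof.
move=> [_ pd]; have [->|/pd/ltW//] := eqVneq u 0.
by rewrite !mul0mx mxE.
Qed.

Lemma ddot_Sigma_gt0 (Lam : 'M[R]_k) : (0 < k)%N -> sym_posdef Lam ->
  0 < ddot (Sigma P pi) Lam.
Proof.
move=> k0 pd.
pose m i := fine (\int[P]_x (score pi x ord0 i)%:E)%E.
pose X i x := score pi x ord0 i - m i.
have iX i j : P.-integrable setT (fun x => (X i x * X j x)%:E).
  exact: score_centered_integrable.
have SE i j : (Sigma P pi i j)%:E = (\int[P]_x (X i x * X j x)%:E)%E.
  have covE : covariance P (fun x => score pi x ord0 i)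
      (fun x => score pi x ord0 j) = (\int[P]_x (X i x * X j x)%:E)%E.
    (* The two unlockings expose the covariance, then the expectations inside it. *)
    by rewrite unlock unlock.
  by rewrite mxE covE fineK//; apply: integrable_fin_num.
pose u x : 'rV[R]_k := \row_i X i x.
pose Q x := (u x *m Lam *m (u x)^T) ord0 ord0.
have QE x : Q x = \sum_i \sum_j Lam i j * (X j x * X i x).
  rewrite /Q mxE exchange_big; apply: eq_bigr => j _ /=.
  rewrite !mxE mulr_suml; apply: eq_bigr => i _; rewrite !mxE; ring.
have iQ : P.-integrable setT (EFin \o Q).
  rewrite (_ : EFin \o Q = fun x =>
      (\sum_i \sum_j (Lam i j)%:E * (X j x * X i x)%:E)%E).
    apply: integrable_sum => // i _; apply: integrable_sum => // j _.
    exact: integrableZl.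
  apply/funext => x /=; rewrite QE -sumEFin; apply: eq_bigr => i _.
  by rewrite -sumEFin.
have EQ : (\int[P]_x (Q x)%:E = (ddot (Sigma P pi) Lam)%:E)%E.
  rewrite /ddot -sumEFin.
  transitivity
    (\int[P]_x (\sum_i \sum_j (Lam i j)%:E * (X j x * X i x)%:E))%E.
    apply: eq_integral => x _; rewrite QE -sumEFin; apply: eq_bigr => i _.
    by rewrite -sumEFin.
  rewrite integral_sum//; last first.
    by move=> i; apply: integrable_sum => // j _; exact: integrableZl.
  apply: eq_bigr => i _; rewrite integral_sum//; last first.
    by move=> j; exact: integrableZl.
  rewrite -sumEFin; apply: eq_bigr => j _.
  by rewrite integralZl// -SE -EFinM mulrC.
have Q0 x : 0 <= Q x by exact: posdef_ge0.
rewrite lt_neqAle -lee_fin -EQ integral_ge0 ?andbT; last first.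
  by move=> x _; rewrite lee_fin.
apply/eqP => dd0.
(* The nonnegative [Q] has zero integral, so it vanishes almost surely. Positive definiteness then
   makes one chosen score component almost surely equal to its mean; k > 0 supplies the
   component. *)
pose i0 := Ordinal k0.
apply: (score_not_cst i0 (m i0)); apply: score_cst_everywhere.
have mQ := measurable_int _ iQ.
have := @ae_eq_integral_abs _ _ R P setT measurableT (EFin \o Q) mQ.
under eq_integral do rewrite /= ger0_norm ?Q0//.
rewrite EQ -dd0 => -[/(_ erefl) [N [mN N0 UN]] _].
apply: (subset_measure0 _ mN _ N0).
  rewrite (_ : mkset _ = (fun x => score pi x ord0 i0) @^-1` (~` [set m i0])).
    rewrite -[X in measurable X]setTI.
    by apply: (measurable_score _ _ mpi dpi) => //; exact: measurableC.
  by apply/seteqP; split => x /= /eqP.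
move=> x /= xm; apply: UN => /= /(_ I) [] /eqP.
have /pd.2 : u x != 0.
  have ux : u x ord0 i0 = X i0 x by rewrite mxE.
  apply: contraNneq xm => u0; move: ux; rewrite u0 [LHS]mxE => /esym/eqP.
  by rewrite /X subr_eq0.
by rewrite -/(Q x) => /gt_eqF ->.
Qed.
End nondegenerate.

End nondegeneracy.

(** * Rescaling *)

Section rescaling.
Context {R : realType}.

Lemma ddotC k (A B : 'M[R]_k) : ddot A B = ddot B A.
Proof.
rewrite /ddot exchange_big; apply: eq_bigr => i _; apply: eq_bigr => j _.
exact: mulrC.
Qed.

Lemma ddotZl k a (A B : 'M[R]_k) : ddot (a *: A) B = a * ddot A B.
Proof.
rewrite /ddot mulr_sumr; apply: eq_bigr => i _.
by rewrite mulr_sumr; apply: eq_bigr => j _; rewrite mxE mulrA.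
Qed.

(** Both terms of [std_generator] carry the factor 1 / (Lambda : Sigma), and both terms of
    [generator] the factor 1/2; the prefactor is the ratio. *)
Lemma generator_std k (P : probability 'rV[R]_k R) (pi : 'rV[R]_k -> R)
    (l : R) (Lam : 'M[R]_k) (f : 'rV[R]_k -> R) (x : 'rV[R]_k) :
  ddot Lam (Sigma P pi) != 0 ->
  generator P pi l Lam f x =
  l ^+ 2 * acceptance P pi Lam l * ddot Lam (Sigma P pi) / 2 *
  std_generator P pi Lam f x.
Proof.
move=> D0; rewrite /generator /std_generator ddotZl -scalemxAr -scalemxAl.
by rewrite [fun_of_matrix (_ *: _) _ _]mxE; field.
Qed.

End rescaling.

Theorem corollary2p5 (R : realType) :
  exists kappa alpha c : R,
    [/\ rounds_to 2 kappa (238 / 100), rounds_to 3 alpha (234 / 1000)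
      & rounds_to 2 c (66 / 100)] /\
    forall (k : nat) (P : probability 'rV[R]_k R) (pi : 'rV[R]_k -> R)
      (Lam : 'M[R]_k),
      (0 < k)%N ->
      has_density P pi ->
      (forall x, 0 < pi x) ->
      (forall x, differentiable (log_density pi) x) ->
      lipschitz (score pi) ->
      sym_posdef Lam ->
      exists l : R,
        unique (maximises_on_pos (fun m => m ^+ 2 * acceptance P pi Lam m)) l /\
        l = kappa / Num.sqrt (ddot (Sigma P pi) Lam) /\
        acceptance P pi Lam l = alpha /\
        c = l ^+ 2 * acceptance P pi Lam l * ddot Lam (Sigma P pi) / 2 /\
        forall (f : 'rV[R]_k -> R) (x : 'rV[R]_k),
          generator P pi l Lam f x = c * std_generator P pi Lam f x.
Proof.
have [y0 [y00 y03 my0 rk [ra rc]]] := @critical_point R.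
(* The three constants are fixed before k, pi and Lambda are introduced; this is the
   universality. *)
exists (2 * y0), (y0 * gauss_density y0),
  (2 * y0 ^+ 2 * (y0 * gauss_density y0)).
split=> // k P pi Lam k0 dP pi0 dpi lpi pd.
have D0 := ddot_Sigma_gt0 _ _ _ dP pi0 dpi lpi Lam k0 pd.
set D := ddot (Sigma P pi) Lam in D0.
have DC : ddot Lam (Sigma P pi) = D by rewrite ddotC.
set s := Num.sqrt D.
have s0 : 0 < s by rewrite sqrtr_gt0.
have sD : s ^+ 2 = D by rewrite sqr_sqrtr// ltW.
have sn0 : s != 0 by rewrite gt_eqF.
have accE m : acceptance P pi Lam m = 2 * upper_tail (m * s / 2) by [].
(* With y = m s / 2, the constant 8 / D is the 4 / s^2 from m^2 times the 2 in the acceptance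
   rate. *)
have FE m : m ^+ 2 * acceptance P pi Lam m = 8 / D * objective (m * s / 2).
  by rewrite accE /objective -sD; field.
pose l := 2 * y0 / s.
have ls : l * s / 2 = y0 by rewrite /l; field.
have accl : acceptance P pi Lam l = y0 * gauss_density y0.
  by rewrite accE ls; move: my0; rewrite /marginal; lra.
have l0 : 0 < l by rewrite divr_gt0// mulr_gt0.
have lt_max m : 0 < m -> m != l -> m ^+ 2 * acceptance P pi Lam m <
    l ^+ 2 * acceptance P pi Lam l.
  move=> m0 ml; rewrite !FE ls ltr_pM2l ?divr_gt0//.
  apply: objective_max => //; first by rewrite divr_gt0// mulr_gt0.
  by apply: contraNneq ml => E; apply/eqP; rewrite /l -E; field.
have cE : 2 * y0 ^+ 2 * (y0 * gauss_density y0) =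
    l ^+ 2 * acceptance P pi Lam l * ddot Lam (Sigma P pi) / 2.
  by rewrite accl DC -sD /l; field.
exists l; split; first split.
- split=> // m m0; have [->//|ml] := eqVneq m l.
  exact/ltW/lt_max.
(* A maximiser other than [l] would have a strictly smaller value than [l]. *)
- move=> m [m0 mmax]; apply/eqP; apply: contraTT isT => lm.
  have := mmax _ l0; rewrite leNgt => /negP; case.
  by apply: lt_max => //; rewrite eq_sym.
do 3![split=> //] => f x.
by rewrite cE generator_std// DC gt_eqF.
Qed.
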